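(* Let $(\mathcal{C},\mathbb{E},\mathfrak{s})$ be an extriangulated category with coproducts. Consider the following statements. (a) $\mathcal{C}$ is AET4. (b) For any set $I\neq\emptyset$, the map $\tau:\mathbb{E}(\coprod_{i\in I}A_i,B)\to\prod_{i\in I}\mathbb{E}(A_i,B)$, $\epsilon\mapsto(\epsilon\cdot\mu_i^A)_{i\in I}$, defines a natural isomorphism (where $\{A_i\}_{i\in I}$ is any family of objects and $B$ any object of $\mathcal{C}$, and $\mu_i^A:A_i\to\coprod_{i\in I}A_i$ are the canonical inclusions). (c) For any objects $V,D$ in $\mathcal{C}$ there is a universal $\mathbb{E}$-extension of $V$ by $D$; that is, there are a set $X\neq\emptyset$ and an $\eta\in\mathbb{E}(V^{(X)},D)$ such that the map $\mathrm{Hom}_{\mathcal{C}}(V,V^{(X)})\to\mathbb{E}(V,D)$, $f\mapsto\eta\cdot f$, is surjective. Then (a)$\Rightarrow$(b) and (b)$\Leftrightarrow$(c). Moreover, if $\mathcal{C}$ is coproduct-compatible, then (a), (b) and (c) are equivalent.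
   Context: **Extriangulated categories (Nakaoka–Palu).** An extriangulated category is a triple $(\mathcal{C},\mathbb{E},\mathfrak{s})$: $\mathcal{C}$ is an additive category, $\mathbb{E}:\mathcal{C}^{op}\times\mathcal{C}\to\mathrm{Ab}$ is an additive bifunctor (for $\delta\in\mathbb{E}(C,A)$, $a:A\to A'$, $c:C'\to C$ write $a\cdot\delta=\mathbb{E}(C,a)(\delta)$, $\delta\cdot c=\mathbb{E}(c,A)(\delta)$), and $\mathfrak{s}$ assigns to each $\delta\in\mathbb{E}(C,A)$ an equivalence class $\mathfrak{s}(\delta)=[A\xrightarrow{x}B\xrightarrow{y}C]$ (two sequences are equivalent if there is an isomorphism of middle terms compatible with the identities of $A$ and $C$), subject to: (i) $\mathfrak{s}(0)=[A\to A\oplus C\to C]$ (canonical maps) and $\mathfrak{s}(\delta\oplus\delta')=\mathfrak{s}(\delta)\oplus\mathfrak{s}(\delta')$; (ii) if $\mathfrak{s}(\delta)=[A\xrightarrow{x}B\xrightarrow{y}C]$, $\mathfrak{s}(\delta')=[A'\xrightarrow{x'}B'\xrightarrow{y'}C']$ and $a:A\to A'$, $c:C\to C'$ satisfy $a\cdot\delta=\delta'\cdot c$, there is $b:B\to B'$ with $bx=x'a$, $y'b=cy$; (iii) (ET3) in the same notation, if $bx=x'a$ there is $c$ with $cy=y'b$ and $a\cdot\delta=\delta'\cdot c$, and dually (ET3$^{op}$); (iv) (ET4) if $\mathfrak{s}(\delta)=[A\xrightarrow{f}B\xrightarrow{f'}D]$ and $\mathfrak{s}(\delta')=[B\xrightarrow{g}C\xrightarrow{g'}F]$,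 there are $\delta''\in\mathbb{E}(E,A)$ with $\mathfrak{s}(\delta'')=[A\xrightarrow{gf}C\xrightarrow{h'}E]$ and morphisms $d:D\to E$, $e:E\to F$ with $df'=h'g$, $eh'=g'$, $\mathfrak{s}(f'\cdot\delta')=[D\xrightarrow{d}E\xrightarrow{e}F]$, $\delta''\cdot d=\delta$, $f\cdot\delta''=\delta'\cdot e$, and dually (ET4$^{op}$). If $\mathfrak{s}(\delta)=[A\xrightarrow{x}B\xrightarrow{y}C]$, the sequence realizes $\delta$ and is called an $\mathfrak{s}$-conflation. **AET3, AET4.** $\mathcal{C}$ is AET3 (has coproducts) if every family of objects indexed by a non-empty set has a coproduct. $A^{(I)}$ is the coproduct of $I$ copies of $A$, and $\mu_i^A:A\to A^{(I)}$, $\mu_i^B:B_i\to\coprod_{i\in I}B_i$ denote canonical inclusions. $\mathcal{C}$ is AET4 if it is AET3 and, for each non-empty set $I$, there is a natural transformation of $\mathrm{Ab}$-valued functors (natural in the family $\{B_i\}_{i\in I}$ and in $A$) $$\Gamma:\prod_{i\in I}\mathbb{E}(B_i,A)\to\mathbb{E}\Big(\coprod_{i\in I}B_i,A^{(I)}\Big)$$ such that (1) if $\eta_i$ is realized by $A\xrightarrow{f_i}E_i\xrightarrow{g_i}B_i$ for all $i\in I$, then $\Gamma(\eta_i)_{i\in I}$ is realized by $A^{(I)}\xrightarrow{\coprod f_i}\coprod_{i\in I}E_i\xrightarrow{\coprod g_i}\coprod_{i\in I}B_i$; and (2) $\Gamma(\eta_i)_{i\in I}\cdot\mu_j^B=\mu_j^A\cdot\eta_j$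 for all $j\in I$. **Negative first extension.** An extriangulated category with negative first extension is one equipped with an additive bifunctor $\mathbb{E}^{-1}:\mathcal{C}^{op}\times\mathcal{C}\to\mathrm{Ab}$ and, for each $\delta\in\mathbb{E}(C,A)$, natural transformations $\mathbb{E}^{-1}(-,C)\to\mathrm{Hom}_{\mathcal{C}}(-,A)$ and $\mathbb{E}^{-1}(A,-)\to\mathrm{Hom}_{\mathcal{C}}(C,-)$ such that, whenever $\mathfrak{s}(\delta)=[A\to B\to C]$ and $W\in\mathcal{C}$, the sequences $\mathbb{E}^{-1}(W,A)\to\mathbb{E}^{-1}(W,B)\to\mathbb{E}^{-1}(W,C)\to\mathrm{Hom}(W,A)\to\mathrm{Hom}(W,B)$ and $\mathbb{E}^{-1}(C,W)\to\mathbb{E}^{-1}(B,W)\to\mathbb{E}^{-1}(A,W)\to\mathrm{Hom}(C,W)\to\mathrm{Hom}(B,W)$ are exact. **Coproduct-compatible.** $\mathcal{C}$ is coproduct-compatible if it is an AET3 extriangulated category with negative first extension and, for every $X\in\mathcal{C}$, every set $I\neq\emptyset$ and every family $\{Y_i\}_{i\in I}$ in $\mathcal{C}$, the map $\mathbb{E}^{-1}(\coprod_{i\in I}Y_i,X)\to\prod_{i\in I}\mathbb{E}^{-1}(Y_i,X)$, $\chi\mapsto(\mathbb{E}^{-1}(\mu_i^Y,X)(\chi))_{i\in I}$, is surjective.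
   Formalization: In the negative first extension, the natural transformations attached to each δ are also required to be natural in δ (compatible with all pairs (a,c) satisfying a·δ = δ'·c); without this, ''(b) implies (a)'' in the ''Moreover'' part is false. *)

(* Defs.v *)
From mathcomp Require Import all_boot all_algebra.

Set Implicit Arguments.
Unset Strict Implicit.
Unset Printing Implicit Defensive.

Import GRing.Theory.
Local Open Scope ring_scope.

Reserved Notation "g \oc f" (at level 40, left associativity).
Reserved Notation "a \push d" (at level 41, right associativity).
Reserved Notation "d \pull c" (at level 40, left associativity).

(* The universe of the "sets" that index coproducts. It contains the carriers
   of abelian groups, so that every Hom(X, Y) and E(X, Y) may serve as an index
   set, while the objects of a category may live in a larger universe. *)
Definition small_set := Type.
Definition small_zmod (M : zmodType) : small_set := M.

Definition surjective (S T : Type) (f : S -> T) : Prop :=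
  forall t, exists s, f s = t.

(* Exactness of U -f-> V -g-> W at V. *)
Definition exact_at (U V W : zmodType) (f : U -> V) (g : V -> W) : Prop :=
  forall v, g v = 0 <-> exists u, f u = v.

(** * Additive categories *)

Record preadditive_category := PreadditiveCategory {
  ob :> Type;
  hom : ob -> ob -> zmodType;
  idm : forall X, hom X X;
  comp : forall X Y Z, hom Y Z -> hom X Y -> hom X Z;
  comp_idl : forall X Y (f : hom X Y), comp (idm Y) f = f;
  comp_idr : forall X Y (f : hom X Y), comp f (idm X) = f;
  compA : forall X Y Z T (h : hom Z T) (g : hom Y Z) (f : hom X Y),
    comp h (comp g f) = comp (comp h g) f;
  compDl : forall X Y Z (g g' : hom Y Z) (f : hom X Y),
    comp (g + g') f = comp g f + comp g' f;
  compDr : forall X Y Z (g : hom Y Z) (f f' : hom X Y),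
    comp g (f + f') = comp g f + comp g f'
}.
Arguments hom {_} _ _.
Arguments idm {_} _.
Arguments comp {_ _ _ _} _ _.
Notation "g \oc f" := (comp g f).

Definition is_iso (C : preadditive_category) (X Y : C) (f : hom X Y) : Prop :=
  exists g : hom Y X, g \oc f = idm X /\ f \oc g = idm Y.

Definition is_zero_object (C : preadditive_category) (Z : C) : Prop :=
  forall X : C,
    (forall f g : hom X Z, f = g) /\ (forall f g : hom Z X, f = g).

Record biproduct (C : preadditive_category) (X Y : C) := Biproduct {
  bi_ob :> ob C;
  bi_in1 : hom X bi_ob;
  bi_in2 : hom Y bi_ob;
  bi_pr1 : hom bi_ob X;
  bi_pr2 : hom bi_ob Y;
  bi_pr1in1 : bi_pr1 \oc bi_in1 = idm X;
  bi_pr2in2 : bi_pr2 \oc bi_in2 = idm Y;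
  bi_pr1in2 : bi_pr1 \oc bi_in2 = 0;
  bi_pr2in1 : bi_pr2 \oc bi_in1 = 0;
  bi_sum : bi_in1 \oc bi_pr1 + bi_in2 \oc bi_pr2 = idm bi_ob
}.

Record additive_category := AdditiveCategory {
  add_preadd :> preadditive_category;
  add_zero : exists Z : add_preadd, is_zero_object Z;
  add_biproduct : forall X Y : add_preadd, inhabited (biproduct X Y)
}.

Definition bi_map (C : preadditive_category) (X Y X' Y' : C)
    (S : biproduct X Y) (S' : biproduct X' Y') (f : hom X X') (g : hom Y Y') :
    hom S S' :=
  bi_in1 S' \oc f \oc bi_pr1 S + bi_in2 S' \oc g \oc bi_pr2 S.

(** * Additive bifunctors C^op x C -> Ab *)

(* [a \push d] is F(C, a)(d) and [d \pull c] is F(c, A)(d). *)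
Record add_bifunctor (C : preadditive_category) := AddBifunctor {
  bif :> C -> C -> zmodType;
  push : forall (X A A' : C), hom A A' -> bif X A -> bif X A';
  pull : forall (X X' A : C), bif X A -> hom X' X -> bif X' A;
  push_id : forall X A (d : bif X A), push (idm A) d = d;
  push_comp : forall X A A' A'' (a' : hom A' A'') (a : hom A A') (d : bif X A),
    push (a' \oc a) d = push a' (push a d);
  pushDl : forall X A A' (a a' : hom A A') (d : bif X A),
    push (a + a') d = push a d + push a' d;
  pushDr : forall X A A' (a : hom A A') (d d' : bif X A),
    push a (d + d') = push a d + push a d';
  pull_id : forall X A (d : bif X A), pull d (idm X) = d;
  pull_comp : forall X X' X'' A (d : bif X A) (c : hom X' X) (c' : hom X'' X'),
    pull d (c \oc c') = pull (pull d c) c';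
  pullDl : forall X X' A (d d' : bif X A) (c : hom X' X),
    pull (d + d') c = pull d c + pull d' c;
  pullDr : forall X X' A (d : bif X A) (c c' : hom X' X),
    pull d (c + c') = pull d c + pull d c';
  push_pull : forall X X' A A' (a : hom A A') (d : bif X A) (c : hom X' X),
    push a (pull d c) = pull (push a d) c
}.
Arguments push {_ _ _ _ _} _ _.
Arguments pull {_ _ _ _ _} _ _.
Notation "a \push d" := (push a d).
Notation "d \pull c" := (pull d c).

(* The element of F(C (+) C', A (+) A') corresponding to (d, 0, 0, d') under
   F(C (+) C', A (+) A') = F(C,A) x F(C,A') x F(C',A) x F(C',A'). *)
Definition ext_sum (C : preadditive_category) (F : add_bifunctor C)
    (X X' A A' : C) (SX : biproduct X X') (SA : biproduct A A')
    (d : F X A) (d' : F X' A') : F SX SA :=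
  bi_in1 SA \push (d \pull bi_pr1 SX) + bi_in2 SA \push (d' \pull bi_pr2 SX).

(** * Extriangulated categories *)

Definition seq_equiv (C : preadditive_category) (A X B B' : C)
    (x : hom A B) (y : hom B X) (x' : hom A B') (y' : hom B' X) : Prop :=
  exists b : hom B B', [/\ is_iso b, b \oc x = x' & y' \oc b = y].

(* [realizes d x y] means s(d) = [A -x-> B -y-> X], for d in E(X, A): the
   equivalence class s(d) is given by its members. *)
Record extriangulated_category := ExtriangulatedCategory {
  ext_cat :> additive_category;
  EE : add_bifunctor ext_cat;
  realizes : forall (A B X : ext_cat),
    EE X A -> hom A B -> hom B X -> Prop;
  realizes_ex : forall (A X : ext_cat) (d : EE X A),
    exists (B : ext_cat) (x : hom A B) (y : hom B X), realizes d x y;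
  realizes_class : forall (A X B B' : ext_cat) (d : EE X A)
      (x : hom A B) (y : hom B X) (x' : hom A B') (y' : hom B' X),
    realizes d x y -> (realizes d x' y' <-> seq_equiv x y x' y');
  realizes_zero : forall (A X : ext_cat) (S : biproduct A X),
    realizes (0 : EE X A) (bi_in1 S) (bi_pr2 S);
  realizes_sum : forall (A B X A' B' X' : ext_cat)
      (SA : biproduct A A') (SB : biproduct B B') (SX : biproduct X X')
      (d : EE X A) (x : hom A B) (y : hom B X)
      (d' : EE X' A') (x' : hom A' B') (y' : hom B' X'),
    realizes d x y -> realizes d' x' y' ->
    realizes (ext_sum SX SA d d') (bi_map SA SB x x') (bi_map SB SX y y');
  realizes_mor : forall (A B X A' B' X' : ext_cat)
      (d : EE X A) (x : hom A B) (y : hom B X)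
      (d' : EE X' A') (x' : hom A' B') (y' : hom B' X')
      (a : hom A A') (c : hom X X'),
    realizes d x y -> realizes d' x' y' -> a \push d = d' \pull c ->
    exists b : hom B B', b \oc x = x' \oc a /\ y' \oc b = c \oc y;
  ET3 : forall (A B X A' B' X' : ext_cat)
      (d : EE X A) (x : hom A B) (y : hom B X)
      (d' : EE X' A') (x' : hom A' B') (y' : hom B' X')
      (a : hom A A') (b : hom B B'),
    realizes d x y -> realizes d' x' y' -> b \oc x = x' \oc a ->
    exists c : hom X X', c \oc y = y' \oc b /\ a \push d = d' \pull c;
  ET3op : forall (A B X A' B' X' : ext_cat)
      (d : EE X A) (x : hom A B) (y : hom B X)
      (d' : EE X' A') (x' : hom A' B') (y' : hom B' X')
      (b : hom B B') (c : hom X X'),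
    realizes d x y -> realizes d' x' y' -> y' \oc b = c \oc y ->
    exists a : hom A A', b \oc x = x' \oc a /\ a \push d = d' \pull c;
  ET4 : forall (A B X D F : ext_cat)
      (d1 : EE D A) (f : hom A B) (f' : hom B D)
      (d2 : EE F B) (g : hom B X) (g' : hom X F),
    realizes d1 f f' -> realizes d2 g g' ->
    exists (E : ext_cat) (d3 : EE E A) (h' : hom X E)
           (d : hom D E) (e : hom E F),
      [/\ realizes d3 (g \oc f) h',
          d \oc f' = h' \oc g /\ e \oc h' = g',
          realizes (f' \push d2) d e,
          d3 \pull d = d1
        & f \push d3 = d2 \pull e];
  ET4op : forall (A B X D F : ext_cat)
      (d1 : EE B D) (f' : hom D A) (f : hom A B)
      (d2 : EE X F) (g' : hom F B) (g : hom B X),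
    realizes d1 f' f -> realizes d2 g' g ->
    exists (E : ext_cat) (d3 : EE X E) (h' : hom E A)
           (d : hom D E) (e : hom E F),
      [/\ realizes d3 h' (g \oc f),
          h' \oc d = f' /\ g' \oc e = f \oc h',
          realizes (d1 \pull g') d e,
          e \push d3 = d2
        & d \push d1 = d3 \pull g]
}.
Arguments EE {_}.
Arguments realizes {_ _ _ _} _ _ _.

(** * Coproducts *)

Record coproduct (C : preadditive_category) (I : small_set) (F : I -> C) :=
  Coproduct {
    cop_ob :> ob C;
    cop_in : forall i, hom (F i) cop_ob;
    cop_desc : forall Y : C, (forall i, hom (F i) Y) -> hom cop_ob Y;
    cop_descE : forall (Y : C) (f : forall i, hom (F i) Y) i,
      cop_desc f \oc cop_in i = f i;
    cop_uniq : forall (Y : C) (g h : hom cop_ob Y),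
      (forall i, g \oc cop_in i = h \oc cop_in i) -> g = h
  }.

Definition cop_map (C : preadditive_category) (I : small_set) (F G : I -> C)
    (S : coproduct F) (T : coproduct G) (f : forall i, hom (F i) (G i)) :
    hom S T :=
  cop_desc S (fun i => cop_in T i \oc f i).

(* A choice of a coproduct for each family indexed by a non-empty set. *)
Definition AET3 (C : preadditive_category) : Type :=
  forall I : small_set, inhabited I -> forall F : I -> C, coproduct F.

Section Conditions.

Variables (C : extriangulated_category) (cop : AET3 C).

Definition copower (I : small_set) (hI : inhabited I) (A : C) :
    coproduct (fun _ : I => A) :=
  cop hI (fun _ : I => A).

Definition AET4 : Prop :=
  forall (I : small_set) (hI : inhabited I),
  exists Gamma : forall (B : I -> C) (A : C),
      (forall i, EE (B i) A) -> EE (cop hI B) (copower hI A),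
  [/\ forall B A (eta eta' : forall i, EE (B i) A),
        Gamma B A (fun i => eta i + eta' i)
          = Gamma B A eta + Gamma B A eta',
      forall (B B' : I -> C) (A A' : C)
          (b : forall i, hom (B' i) (B i)) (a : hom A A')
          (eta : forall i, EE (B i) A),
        Gamma B' A' (fun i => a \push (eta i \pull b i))
          = cop_map (copower hI A) (copower hI A') (fun _ => a)
              \push (Gamma B A eta \pull cop_map (cop hI B') (cop hI B) b),
      forall B A (eta : forall i, EE (B i) A) (E : I -> C)
          (f : forall i, hom A (E i)) (g : forall i, hom (E i) (B i)),
        (forall i, realizes (eta i) (f i) (g i)) ->
        realizes (Gamma B A eta)
          (cop_map (copower hI A) (cop hI E) f)
          (cop_map (cop hI E) (cop hI B) g)
    & forall B A (eta : forall i, EE (B i) A) (j : I),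
        Gamma B A eta \pull cop_in (cop hI B) j
          = cop_in (copower hI A) j \push eta j].

Definition tau (I : small_set) (hI : inhabited I) (A : I -> C) (B : C)
    (eps : EE (cop hI A) B) : forall i, EE (A i) B :=
  fun i => eps \pull cop_in (cop hI A) i.

Definition tau_natural_iso : Prop :=
  forall (I : small_set) (hI : inhabited I),
  [/\ forall (A : I -> C) (B : C) (eps eps' : EE (cop hI A) B) i,
        tau (eps + eps') i = tau eps i + tau eps' i,
      forall (A A' : I -> C) (B B' : C)
          (a : forall i, hom (A' i) (A i)) (b : hom B B')
          (eps : EE (cop hI A) B) i,
        tau (b \push (eps \pull cop_map (cop hI A') (cop hI A) a)) i
          = b \push (tau eps i \pull a i)
    & forall (A : I -> C) (B : C), bijective (@tau I hI A B)].

Definition has_universal_extensions : Prop :=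
  forall V D : C,
  exists (X : small_set) (hX : inhabited X) (eta : EE (copower hX V) D),
    surjective (fun f : hom V (copower hX V) => eta \pull f).

End Conditions.

(** * Negative first extensions *)

(* For d in E(X, A), [ncov d] and [ncon d] are the transformations
   E^-1(-, X) -> Hom(-, A) and E^-1(A, -) -> Hom(X, -). They are natural in the
   remaining variable ([ncov_nat], [ncon_nat]) and, as connecting maps of long
   exact sequences, in the extension d ([ncov_ext], [ncon_ext]): a morphism of
   extensions d -> d', i.e. a pair (a, c) with a.d = d'.c, induces commutative
   squares. The latter does not follow from the other fields, which allow the
   maps attached to different extensions to be chosen independently. *)
Record negative_extension (C : extriangulated_category) := NegativeExtension {
  negE :> add_bifunctor C;
  ncov : forall (X A : C), EE X A -> forall W, negE W X -> hom W A;
  ncon : forall (X A : C), EE X A -> forall W, negE A W -> hom X W;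
  ncovD : forall X A (d : EE X A) W (u v : negE W X),
    ncov d (u + v) = ncov d u + ncov d v;
  nconD : forall X A (d : EE X A) W (u v : negE A W),
    ncon d (u + v) = ncon d u + ncon d v;
  ncov_nat : forall X A (d : EE X A) W W' (w : hom W' W) (u : negE W X),
    ncov d (u \pull w) = ncov d u \oc w;
  ncon_nat : forall X A (d : EE X A) W W' (w : hom W W') (u : negE A W),
    ncon d (w \push u) = w \oc ncon d u;
  ncov_ext : forall X A X' A' (d : EE X A) (d' : EE X' A')
      (a : hom A A') (c : hom X X'), a \push d = d' \pull c ->
    forall W (u : negE W X), ncov d' (c \push u) = a \oc ncov d u;
  ncon_ext : forall X A X' A' (d : EE X A) (d' : EE X' A')
      (a : hom A A') (c : hom X X'), a \push d = d' \pull c ->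
    forall W (u : negE A' W), ncon d (u \pull a) = ncon d' u \oc c;
  ncov_exact : forall (A B X : C) (d : EE X A) (x : hom A B) (y : hom B X),
    realizes d x y -> forall W : C,
    [/\ exact_at (fun u : negE W A => x \push u) (fun u : negE W B => y \push u),
        exact_at (fun u : negE W B => y \push u) (@ncov X A d W)
      & exact_at (@ncov X A d W) (fun f : hom W A => x \oc f)];
  ncon_exact : forall (A B X : C) (d : EE X A) (x : hom A B) (y : hom B X),
    realizes d x y -> forall W : C,
    [/\ exact_at (fun u : negE X W => u \pull y) (fun u : negE B W => u \pull x),
        exact_at (fun u : negE B W => u \pull x) (@ncon X A d W)
      & exact_at (@ncon X A d W) (fun f : hom X W => f \oc y)]
}.

Definition coproduct_compatible (C : extriangulated_category) (cop : AET3 C)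
    (N : negative_extension C) : Prop :=
  forall (X : C) (I : small_set) (hI : inhabited I) (Y : I -> C)
      (chi : forall i, N (Y i) X),
  exists u : N (cop I hI Y) X, forall i, u \pull cop_in (cop I hI Y) i = chi i.

(* Main.v *)
From mathcomp Require Import all_boot.
From mathcomp Require Import all_algebra.
From mathcomp Require Import boolp.
Require Import Defs.

(** The map [tau] is injective in every extriangulated category: if
    [A -x-> B -y-> X] realizes [e], an arrow [c : W -> X] lifts along [y] as
    soon as [e \pull c = 0]; when [X] is a coproduct and [e] vanishes along
    each inclusion, the lifts of the inclusions assemble to a section of [y],
    and an extension whose deflation splits is zero.  Hence (b) only says that
    every family of extensions is glued by a single one
    ([tau_natural_iso_glue]).

    (a) => (b): push [Gamma eta] forward along the codiagonal of the copower.

    (b) => (c): index a copower of [V] by the set [E(V, D)] itself and glue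
    the tautological family.

    (c) => (b): the coproduct [V] of the [A i] retracts onto each of them, so
    each [eta i] is a restriction of an extension of [V], which is a pull-back
    of the universal one along some arrow; restrict these arrows to the [A i]
    and glue them.

    (b) => (a), with negative extensions compatible with coproducts: by (b),
    there is a unique [Gamma eta] with
    [Gamma eta \pull mu_j = mu_j \push eta_j], and uniqueness makes it additive
    and natural.  A conflation [K -> M -> T] realizing it receives the
    conflations of the [eta_j], whence a comparison arrow from the coproduct of
    their middle terms to [M].  Composition with that arrow is a bijection on
    [Hom(-, W)] by a five lemma argument ([glued_comparison_onto] and
    [glued_comparison_epi]); the term [E^-1] to the left of the sequence is
    where compatibility enters.  So the arrow is an isomorphism, which is what
    it means for the coproduct sequence to realize [Gamma eta]. *)

Set Implicit Arguments.
Unset Strict Implicit.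
Unset Printing Implicit Defensive.

Import GRing.Theory.
Local Open Scope ring_scope.

Lemma choice_dep (I : Type) (T : I -> Type) (P : forall i, T i -> Prop) :
  (forall i, exists t, P i t) -> exists f : forall i, T i, forall i, P i (f i).
Proof.
by move=> ex; exists (fun i => sval (cid (ex i))) => i; apply: svalP.
Qed.

(** * Zero arrows and zero extensions *)

Lemma additive0 (U V : zmodType) (f : U -> V) :
  (forall u v, f (u + v) = f u + f v) -> f 0 = 0.
Proof. by move=> fD; apply: (addrI (f 0)); rewrite -fD !addr0. Qed.

Section Zero.

Variable C : preadditive_category.

Lemma comp0l (X Y Z : C) (f : hom X Y) : (0 : hom Y Z) \oc f = 0.
Proof. by apply: (additive0 (f := fun g => g \oc f)) => g g'; apply: compDl. Qed.

Lemma comp0r (X Y Z : C) (g : hom Y Z) : g \oc (0 : hom X Y) = 0.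
Proof. by apply: (additive0 (f := fun f => g \oc f)) => f f'; apply: compDr. Qed.

Lemma compBl (X Y Z : C) (g g' : hom Y Z) (f : hom X Y) :
  (g - g') \oc f = g \oc f - g' \oc f.
Proof. by apply: (addIr (g' \oc f)); rewrite -compDl !subrK. Qed.

Variable F : add_bifunctor C.

Lemma push0 (X A A' : C) (a : hom A A') : a \push (0 : F X A) = 0.
Proof. by apply: additive0 => d d'; apply: pushDr. Qed.

Lemma push0l (X A A' : C) (d : F X A) : (0 : hom A A') \push d = 0.
Proof. by apply: (additive0 (f := fun a => a \push d)) => a a'; apply: pushDl. Qed.

Lemma pull0 (X X' A : C) (c : hom X' X) : (0 : F X A) \pull c = 0.
Proof. by apply: (additive0 (f := fun d => d \pull c)) => d d'; apply: pullDl. Qed.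

Lemma pull0r (X X' A : C) (d : F X A) : d \pull (0 : hom X' X) = 0.
Proof. by apply: (additive0 (f := fun c => d \pull c)) => c c'; apply: pullDr. Qed.

Lemma pullBl (X X' A : C) (d d' : F X A) (c : hom X' X) :
  (d - d') \pull c = d \pull c - d' \pull c.
Proof. by apply: (addIr (d' \pull c)); rewrite -pullDl !subrK. Qed.

End Zero.

(** * The long exact sequences of a conflation *)

Section Exactness.

Variable C : extriangulated_category.

(** Comparing a conflation with the trivial conflations [0 -> B -> B] and
    [B -> B -> 0] turns the axioms on morphisms of conflations into the
    exactness statements below. *)
Lemma realizes_zero_idr (Z B : C) :
  is_zero_object Z -> realizes (0 : EE B Z) (0 : hom Z B) (idm B).
Proof.
move=> Z0.
have eZ : (0 : hom B Z) \oc (0 : hom Z B) = idm Z by exact: (Z0 Z).1.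
have e1 : idm B \oc idm B = idm B by exact: comp_idl.
have e12 : (0 : hom B Z) \oc idm B = 0 by exact: comp0l.
have e21 : idm B \oc (0 : hom Z B) = 0 by exact: comp_idl.
have es : (0 : hom Z B) \oc (0 : hom B Z) + idm B \oc idm B = idm B.
  by rewrite comp0l add0r e1.
exact: (realizes_zero (Biproduct eZ e1 e12 e21 es)).
Qed.

Lemma realizes_zero_idl (Z B : C) :
  is_zero_object Z -> realizes (0 : EE Z B) (idm B) (0 : hom B Z).
Proof.
move=> Z0.
have eZ : (0 : hom B Z) \oc (0 : hom Z B) = idm Z by exact: (Z0 Z).1.
have e1 : idm B \oc idm B = idm B by exact: comp_idl.
have e12 : idm B \oc (0 : hom Z B) = 0 by exact: comp_idl.
have e21 : (0 : hom B Z) \oc idm B = 0 by exact: comp0l.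
have es : idm B \oc idm B + (0 : hom Z B) \oc (0 : hom B Z) = idm B.
  by rewrite comp0l addr0 e1.
exact: (realizes_zero (Biproduct e1 eZ e12 e21 es)).
Qed.

Variables (A B X : C) (d : EE X A) (x : hom A B) (y : hom B X).
Hypothesis dxy : realizes d x y.

(** The square with identity on [B] maps the conflation [0 -> B -> B] to the
    given one, so [d \pull y] is pushed forward from [E(B, 0)]. *)
Lemma pull_deflation : d \pull y = 0.
Proof.
have [Z Z0] := add_zero C.
have sq : y \oc idm B = y \oc idm B by [].
have [a [_ <-]] := ET3op (realizes_zero_idr B Z0) dxy sq.
exact: push0.
Qed.

Lemma push_inflation : x \push d = 0.
Proof.
have [Z Z0] := add_zero C.
have sq : idm B \oc x = idm B \oc x by [].
have [c [_ ->]] := ET3 dxy (realizes_zero_idl B Z0) sq.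
exact: pull0.
Qed.

(** Such a [c] is the right end of a morphism from [0 -> W -> W], whose middle
    component is the lift. *)
Lemma lift_deflation (W : C) (c : hom W X) :
  d \pull c = 0 -> exists s : hom W B, y \oc s = c.
Proof.
move=> dc0; have [Z Z0] := add_zero C.
have sq : (0 : hom Z A) \push (0 : EE W Z) = d \pull c by rewrite push0 dc0.
have [s [_ ys]] := realizes_mor (realizes_zero_idr W Z0) dxy sq.
by exists s; rewrite ys comp_idr.
Qed.

Lemma extend_inflation (W : C) (a : hom A W) :
  a \push d = 0 -> exists t : hom B W, t \oc x = a.
Proof.
move=> ad0; have [Z Z0] := add_zero C.
have sq : a \push d = (0 : EE Z W) \pull (0 : hom X Z) by rewrite pull0 ad0.
have [t [tx _]] := realizes_mor dxy (realizes_zero_idl W Z0) sq.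
by exists t; rewrite tx comp_idl.
Qed.

Lemma factor_deflation (W : C) (k : hom B W) :
  k \oc x = 0 -> exists l : hom X W, l \oc y = k.
Proof.
move=> kx0; have [Z Z0] := add_zero C.
have sq : k \oc x = (0 : hom Z W) \oc (0 : hom A Z) by rewrite comp0r kx0.
have [l [ly _]] := ET3 dxy (realizes_zero_idr W Z0) sq.
by exists l; rewrite ly comp_idl.
Qed.

End Exactness.

(** * Extensions of a coproduct *)

Lemma cop_map_in (C : preadditive_category) (I : small_set) (F G : I -> C)
    (S : coproduct F) (T : coproduct G) (f : forall i, hom (F i) (G i)) i :
  cop_map S T f \oc cop_in S i = cop_in T i \oc f i.
Proof. exact: cop_descE. Qed.

(** The identity on the summand [i] and zero arrows on the others. *)
Lemma cop_retract (C : preadditive_category) (I : small_set) (F : I -> C)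
    (S : coproduct F) i :
  exists p : hom S (F i), p \oc cop_in S i = idm (F i).
Proof.
pose f j : hom (F j) (F i) :=
  if pselect (j = i) is left e then ecast k (hom (F j) (F k)) e (idm (F j))
  else 0.
exists (cop_desc S f); rewrite cop_descE /f.
case: pselect => // e.
(* a proof of [i = i] may be replaced with [erefl] *)
by rewrite (Prop_irrelevance e erefl).
Qed.

Section Glue.

Variable C : extriangulated_category.

(** The lifts of the inclusions along the deflation [y] of a conflation
    realizing [e] form a section [s] of it, and
    [e = (e \pull y) \pull s = 0]. *)
Lemma pull_cop_in_eq0 (I : small_set) (F : I -> C) (S : coproduct F) (B : C)
    (e : EE S B) :
  (forall i, e \pull cop_in S i = 0) -> e = 0.
Proof.
move=> e0; have [M [x [y exy]]] := realizes_ex e.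
have /choice_dep [s ys] i := lift_deflation exy (e0 i).
have sec : y \oc cop_desc S s = idm S.
  by apply: cop_uniq => i; rewrite -compA cop_descE ys comp_idl.
by rewrite -[e]pull_id -sec pull_comp (pull_deflation exy) pull0.
Qed.

Lemma pull_cop_in_inj (I : small_set) (F : I -> C) (S : coproduct F) (B : C)
    (e e' : EE S B) :
  (forall i, e \pull cop_in S i = e' \pull cop_in S i) -> e = e'.
Proof.
move=> ee'; apply/eqP; rewrite -subr_eq0; apply/eqP.
by apply: pull_cop_in_eq0 => i; rewrite pullBl ee' subrr.
Qed.

Variable cop : AET3 C.

Definition extensions_glue : Prop :=
  forall (I : small_set) (hI : inhabited I) (A : I -> C) (B : C)
    (eta : forall i, EE (A i) B),
  exists e : EE (cop hI A) B, forall i, e \pull cop_in (cop hI A) i = eta i.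

Lemma tau_natural_iso_glue : tau_natural_iso cop <-> extensions_glue.
Proof.
split=> [iso I hI A B eta | glue I hI].
  have [_ _ /(_ A B) [g _ gK]] := iso I hI.
  by exists (g eta) => i; rewrite -[in RHS](gK eta).
split=> [A B e e' i | A A' B B' a b e i | A B].
- exact: pullDl.
- by rewrite /tau -push_pull -pull_comp cop_map_in pull_comp.
have /choice [g gP] : forall eta : (forall i, EE (A i) B),
    exists e : EE (cop hI A) B, forall i, e \pull cop_in (cop hI A) i = eta i.
  exact: glue.
exists g => [e | eta].
  by apply: pull_cop_in_inj => i; rewrite gP.
by apply: functional_extensionality_dep => i; exact: gP.
Qed.

(** * Gluing from exact coproducts, and universal extensions *)

Lemma AET4_glue : AET4 cop -> extensions_glue.
Proof.
move=> ex I hI A B eta; have [Gamma [_ _ _ GammaP]] := ex I hI.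
exists (cop_desc (copower cop hI B) (fun=> idm B) \push Gamma A B eta) => i.
by rewrite -push_pull GammaP -push_comp cop_descE push_id.
Qed.

Lemma glue_universal : extensions_glue -> has_universal_extensions cop.
Proof.
move=> glue V D.
have hX : inhabited (small_zmod (EE V D)) by exact: (inhabits (0 : EE V D)).
have [eta etaP] :=
  @glue (small_zmod (EE V D)) hX (fun=> V) D (fun e => e).
exists (small_zmod (EE V D)), hX, eta => e.
by exists (cop_in (copower cop hX V) e); apply: etaP.
Qed.

Lemma universal_glue : has_universal_extensions cop -> extensions_glue.
Proof.
move=> univ I hI A B eta; set S := cop hI A.
have [X [hX [u uP]]] := univ S B.
have /choice_dep [f fP] i :
    exists f : hom (A i) (copower cop hX S), u \pull f = eta i.
  have [p pi] := cop_retract S i; have [f uf] := uP (eta i \pull p).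
  by exists (f \oc cop_in S i); rewrite pull_comp uf -pull_comp pi pull_id.
by exists (u \pull cop_desc S f) => i; rewrite -pull_comp cop_descE.
Qed.

End Glue.

(** * The coproduct of a family of conflations *)

(** A conflation [K -x-> M -y-> T] of [G], where [G] restricts to the
    [eta i] on the inclusions into [T], with the induced arrow [phi] from the
    coproduct [P] of the middle terms of conflations of the [eta i]. *)
Section Comparison.

Variables (C : extriangulated_category) (I : small_set) (A B E : I -> C).
Variables (K : coproduct A) (P : coproduct E) (T : coproduct B).
Variables (eta : forall i, EE (B i) (A i)).
Variables (f : forall i, hom (A i) (E i)) (g : forall i, hom (E i) (B i)).
Hypothesis etaP : forall i, realizes (eta i) (f i) (g i).
Variables (G : EE T K) (M : C) (x : hom K M) (y : hom M T).
Hypothesis Gxy : realizes G x y.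
Hypothesis GP : forall i, cop_in K i \push eta i = G \pull cop_in T i.
Variable phi : hom P M.
Hypothesis phix : phi \oc cop_map K P f = x.
Hypothesis yphi : y \oc phi = cop_map P T g.

Lemma glued_comparison_onto (W : C) (h : hom P W) :
  exists k : hom M W, k \oc phi = h.
Proof.
(* the restriction of [h] to [K] extends to [M] since it kills [G] *)
have [k kx] : exists k : hom M W, k \oc x = h \oc cop_map K P f.
  apply: (extend_inflation Gxy); apply: pull_cop_in_eq0 => i.
  rewrite -push_pull -GP -push_comp -compA cop_map_in !push_comp.
  by rewrite (push_inflation (etaP i)) !push0.
(* the remaining defect vanishes on [K], so it comes from [T] *)
have /choice_dep [l lg] i :
    exists l : hom (B i) W, l \oc g i = (h - k \oc phi) \oc cop_in P i.
  apply: (factor_deflation (etaP i)).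
  rewrite -compA -(cop_map_in K) compA compBl -!(compA k) phix kx subrr.
  exact: comp0l.
exists (k + cop_desc T l \oc y); rewrite compDl -(compA _ y) yphi.
suff -> : cop_desc T l \oc cop_map P T g = h - k \oc phi by rewrite addrC subrK.
by apply: cop_uniq => i; rewrite -compA cop_map_in compA cop_descE lg.
Qed.

Variable N : negative_extension C.

(** If [k] kills [phi] then [k] factors as [l \oc y], and [l] dies in each
    [E i], so it comes from [E^-1(A i, W)] on each summand.  Lifting the family
    of these elements to [E^-1(K, W)] shows that [l] is a connecting image, and
    [l \oc y = 0]. *)
Lemma glued_comparison_epi (W : C) (k : hom M W) :
  (forall chi : forall i, N (A i) W,
     exists u : N K W, forall i, u \pull cop_in K i = chi i) ->
  k \oc phi = 0 -> k = 0.
Proof.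
move=> lift kphi.
have [l lyk] : exists l : hom T W, l \oc y = k.
  by apply: (factor_deflation Gxy); rewrite -phix compA kphi comp0l.
have /choice_dep [chi chiP] i :
    exists u : N (A i) W, ncon (eta i) u = l \oc cop_in T i.
  have [_ _ /(_ (l \oc cop_in T i)) ex] := ncon_exact N (etaP i) W.
  apply/ex; rewrite -compA -(cop_map_in P) -yphi compA (compA l) lyk kphi.
  exact: comp0l.
have [u uP] := lift chi.
have Gu : ncon G u = l.
  by apply: cop_uniq => i; rewrite -(ncon_ext (GP i)) uP chiP.
have [_ _ /(_ l) ex] := ncon_exact N Gxy W.
by rewrite -lyk; apply/ex; exists u.
Qed.

Lemma glued_comparison_iso :
  (forall W (chi : forall i, N (A i) W),
     exists u : N K W, forall i, u \pull cop_in K i = chi i) ->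
  is_iso phi.
Proof.
move=> lift; have [psi psiphi] := glued_comparison_onto (idm P).
exists psi; split=> //; apply/eqP; rewrite -subr_eq0; apply/eqP.
apply: glued_comparison_epi; first exact: lift.
by rewrite compBl -compA psiphi comp_idl comp_idr subrr.
Qed.

End Comparison.

(** A conflation realizing [G] exists anyway; the comparison arrow identifies
    the coproduct sequence with it. *)
Lemma realizes_coproduct (C : extriangulated_category) (I : small_set)
    (A B E : I -> C) (K : coproduct A) (P : coproduct E) (T : coproduct B)
    (eta : forall i, EE (B i) (A i))
    (f : forall i, hom (A i) (E i)) (g : forall i, hom (E i) (B i))
    (G : EE T K) (N : negative_extension C) :
  (forall W (chi : forall i, N (A i) W),
     exists u : N K W, forall i, u \pull cop_in K i = chi i) ->
  (forall i, realizes (eta i) (f i) (g i)) ->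
  (forall i, G \pull cop_in T i = cop_in K i \push eta i) ->
  realizes G (cop_map K P f) (cop_map P T g).
Proof.
move=> lift etaP /(_ _)/esym GP; have [M [x [y Gxy]]] := realizes_ex G.
have /choice_dep [b bP] i := realizes_mor (etaP i) Gxy (GP i).
pose phi := cop_desc P b.
have phix : phi \oc cop_map K P f = x.
  apply: cop_uniq => i; rewrite -compA cop_map_in compA cop_descE.
  by have [-> _] := bP i.
have yphi : y \oc phi = cop_map P T g.
  apply: cop_uniq => i; rewrite -compA cop_map_in cop_descE.
  by have [_ ->] := bP i.
have [psi [psiphi phipsi]] := glued_comparison_iso etaP Gxy GP phix yphi lift.
apply/(realizes_class _ _ Gxy); exists psi; split.
- by exists phi.
- by rewrite -phix compA psiphi comp_idl.
- by rewrite -yphi -compA phipsi comp_idr.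
Qed.

Lemma glue_AET4 (C : extriangulated_category) (cop : AET3 C)
    (N : negative_extension C) :
  coproduct_compatible cop N -> extensions_glue cop -> AET4 cop.
Proof.
move=> compat glue I hI.
have GammaP (B : I -> C) (A : C) (eta : forall i, EE (B i) A) :
    {e : EE (cop I hI B) (copower cop hI A) | forall j,
      e \pull cop_in (cop I hI B) j = cop_in (copower cop hI A) j \push eta j}.
  by apply: cid; apply: glue.
exists (fun B A eta => sval (GammaP B A eta)).
split=> [B A eta eta' | B B' A A' b a eta | B A eta E f g etaP | B A eta j].
- apply: pull_cop_in_inj => i.
  by rewrite pullDl !(svalP (GammaP _ _ _)) pushDr.
- apply: pull_cop_in_inj => i; rewrite (svalP (GammaP _ _ _)).
  rewrite -push_pull -pull_comp cop_map_in pull_comp (svalP (GammaP _ _ _)).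
  by rewrite -push_pull -!push_comp cop_map_in.
- apply: realizes_coproduct etaP (svalP (GammaP _ _ _)) => W.
  exact: compat.
- exact: (svalP (GammaP _ _ _)).
Qed.

(** * The equivalences *)

Theorem theoremA (C : extriangulated_category) (cop : AET3 C) :
  [/\ AET4 cop -> tau_natural_iso cop,
      tau_natural_iso cop <-> has_universal_extensions cop
    & forall N : negative_extension C, coproduct_compatible cop N ->
        (AET4 cop <-> tau_natural_iso cop) /\
        (tau_natural_iso cop <-> has_universal_extensions cop)].
Proof.
have ab : AET4 cop -> tau_natural_iso cop.
  by move=> /AET4_glue /tau_natural_iso_glue.
have bc : tau_natural_iso cop <-> has_universal_extensions cop.
  split=> [/tau_natural_iso_glue /glue_universal // |].
  by move=> /universal_glue /tau_natural_iso_glue.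
split=> // N compat; split=> //; split=> //.
by move=> /tau_natural_iso_glue; apply: glue_AET4 compat.
Qed.
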